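(* Let $P$ be a symplectic space of dimension $2n$ over a field $\mathbb{K}$, let $S\subset P$ be an isotropic subspace of dimension $n-k$, and let $\alpha\subset P$ be a subspace. Put $$\ell_M=\dim\big(((\alpha\cap S^\bot)+S)/S\big),\qquad \ell_{M^c}=\dim\big(((\alpha^\bot\cap S^\bot)+S)/S\big).$$ Then $$\ell_M+\ell_{M^c}=2k.$$ In particular, if $\ell_M=0$, then $\ell_{M^c}=2k$, hence for any $v\in S^\bot$ there exists $v'\in S^\bot\cap\alpha^\bot$ such that $v-v'\in S$.
   Context: A symplectic space is a finite-dimensional vector space with a nondegenerate alternating bilinear form; ${}^\bot$ denotes the orthogonal subspace with respect to this form; $S$ isotropic means $S\subset S^\bot$. (In the coding interpretation $P$ is the reduced Pauli group on $n$ qubits, $S$ the stabilizer group of a stabilizer code of dimension $k$, $\alpha$ and $\alpha^\bot$ the operators supported on a set $M$ of qubits and on its complement $M^c$; the subscripts $M$, $M^c$ are labels referring to $\alpha$, $\alpha^\bot$.) *)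

(* Defs.v *)
From HB Require Import structures.
From mathcomp Require Import all_boot all_order all_algebra.

Set Implicit Arguments.
Unset Strict Implicit.
Unset Printing Implicit Defensive.

Import GRing.Theory VectorInternalTheory.

Local Open Scope ring_scope.
Local Open Scope quotient_scope.

Section QuotientSpace.

Variables (K : fieldType) (V : vectType K) (S : {vspace V}).

(* The library quotient of the additive group V by S (u ~ v iff u - v \in S), *)
(* on which the K-vector space structure is added below.                      *)
Definition quotv : Type := @Quotient.quot V (pred_of_vspace S).

HB.instance Definition _ := Choice.on quotv.
HB.instance Definition _ := GRing.Zmodule.on quotv.

Definition projq (v : V) : quotv :=
  \pi_(@Quotient.quot V (pred_of_vspace S)) v.

Definition reprq (x : quotv) : V :=
  repr (x : @Quotient.quot V (pred_of_vspace S)).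

Lemma reprqK x : projq (reprq x) = x.
Proof. exact: reprK. Qed.

Lemma projq_eq u v : (projq u == projq v) = (u - v \in S).
Proof.
by rewrite -(@Quotient.idealrBE V (pred_of_vspace S)).
Qed.

Lemma projqK v : reprq (projq v) - v \in S.
Proof. by rewrite -projq_eq reprqK. Qed.

Lemma projqB : {morph projq : u v / u - v}.
Proof. exact: (raddfB (\pi_(@Quotient.quot V (pred_of_vspace S)))). Qed.

Lemma projqD : {morph projq : u v / u + v}.
Proof. exact: (raddfD (\pi_(@Quotient.quot V (pred_of_vspace S)))). Qed.

Definition scaleq (a : K) (x : quotv) : quotv := projq (a *: reprq x).

Lemma scaleq_pi a v : scaleq a (projq v) = projq (a *: v).
Proof. by apply/eqP; rewrite projq_eq -scalerBr memvZ ?projqK. Qed.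

Fact scaleqA a b x : scaleq a (scaleq b x) = scaleq (a * b) x.
Proof. by rewrite -[x]reprqK !scaleq_pi scalerA. Qed.

Fact scale1q : left_id 1 scaleq.
Proof. by move=> x; rewrite -[x]reprqK scaleq_pi scale1r. Qed.

Fact scaleqDr : right_distributive scaleq +%R.
Proof.
move=> a x y; rewrite -[x]reprqK -[y]reprqK.
by rewrite -projqD !scaleq_pi scalerDr projqD.
Qed.

Fact scaleqDl x : {morph scaleq^~ x : a b / a + b}.
Proof.
by move=> a b /=; rewrite -[x]reprqK !scaleq_pi scalerDl projqD.
Qed.

HB.instance Definition _ :=
  GRing.Zmodule_isLmodule.Build K quotv scaleqA scale1q scaleqDr scaleqDl.

Fact projq_is_linear : linear projq.
Proof. by move=> a u v; rewrite projqD -scaleq_pi. Qed.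

HB.instance Definition _ :=
  GRing.isLinear.Build K V quotv *:%R projq projq_is_linear.

(* V / S is finite-dimensional: it is isomorphic to the complement S^C of S. *)
Fact quotv_vect_iso : Vector.axiom (\dim (S^C)%VS) quotv.
Proof.
have capS : (S^C :&: S = 0)%VS by rewrite capvC capv_compl.
have addS v : v \in (S^C + S)%VS by rewrite addvC addv_complf memvf.
pose p := daddv_pi S^C%VS S; pose q := daddv_pi S S^C%VS.
have pS v : (p v == 0) = (v \in S).
  apply/eqP/idP => [pv0|Sv].
    by rewrite -(daddv_pi_add capS (addS v)) -/p pv0 add0r memv_pi.
  have := daddv_pi_add capS (addS v).
  rewrite (daddv_pi_id _ Sv) ?capv_compl // -[RHS]add0r.
  exact: addIr.
have p_repr v : p (reprq (projq v)) = p v.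
  by apply/eqP; rewrite -subr_eq0 -linearB pS projqK.
pose g (x : quotv) : subvs_of S^C%VS := vsproj _ (p (reprq x)).
have gP : linear g.
  move=> a x y; rewrite /g -[in LHS](reprqK x) -[in LHS](reprqK y).
  rewrite -projq_is_linear p_repr linearP /=.
  exact: linearP.
exists (fun x => v2r (g x)) => [a x y|]; first by rewrite gP linearP.
exists (fun r => projq (vsval (r2v r : subvs_of S^C%VS))) => [x|r] /=.
  rewrite v2rK /g vsprojK ?memv_pi // -[RHS]reprqK; apply/eqP.
  rewrite projq_eq -pS linearB subr_eq0; apply/eqP.
  exact: daddv_pi_proj.
by rewrite /g p_repr /p daddv_pi_id ?subvsP // vsvalK r2vK.
Qed.

HB.instance Definition _ := Lmodule_hasFinDim.Build K quotv quotv_vect_iso.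

Lemma lker_projq : lker (linfun projq) = S.
Proof.
apply/vspaceP => v; rewrite memv_ker lfunE /=.
by rewrite -(linear0 projq) projq_eq subr0.
Qed.

(* The subspace U / S of V / S; U is not required to contain S, in general    *)
(* this is (U + S) / S.                                                       *)
Definition quotvs (U : {vspace V}) : {vspace quotv} :=
  (linfun projq @: U)%VS.

End QuotientSpace.

(* Main.v *)
(* Write a^o for the orthogonal of a. Nondegeneracy gives                     *)
(* dim U + dim U^o = 2n and U^oo = U for every U. Since S lies in S^o,        *)
(* l_M = dim (a & S^o) - dim (a & S), and similarly                           *)
(* l_Mc = dim (a^o & S^o) - dim (a^o & S), where a^o & S^o = (a + S)^o and    *)
(* a^o & S = (a + S^o)^o. The formula for the dimension of a sum now turns    *)
(* l_Mc into 2n - 2 dim S - l_M = 2k - l_M. When l_M = 0, this makes the      *)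
(* image of a^o & S^o in S^o / S full, since dim (S^o / S) = 2k.              *)
Require Import Defs.
From HB Require Import structures.
From mathcomp Require Import all_boot all_order all_algebra.
From mathcomp Require Import zify.

Set Implicit Arguments.
Unset Strict Implicit.
Unset Printing Implicit Defensive.

Import GRing.Theory.

Local Open Scope ring_scope.

Section OrthogonalDimension.

Variables (F : fieldType) (eps : bool) (theta : {rmorphism F -> F}).
Variables (vT : vectType F) (form : {hermitian vT for eps & theta}).
Implicit Types U V : {vspace vT}.

Local Notation orth := (orthov form).

Lemma orthov_add U V : (orth (U + V) = orth U :&: orth V)%VS.
Proof.
apply/vspaceP=> u; rewrite memv_cap !memvE.
exact: orthovD.
Qed.

(** Each vector of a basis of [V] imposes one linear condition on [U], which lowers the dimension by
    at most one. *)
Lemma leq_dim_cap_orthov U V : (\dim U <= \dim (U :&: orth V) + \dim V)%N.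
Proof.
have span_bound (X : seq vT) : (\dim U <= \dim (U :&: orth <<X>>) + size X)%N.
  elim: X => [|x X IHX]; first by rewrite span_nil orthov0 capvf addn0.
  rewrite span_cons orthov_add [(orth <[x]> :&: _)%VS]capvC capvA.
  apply: leq_trans IHX _; rewrite /= addnS -addSn leq_add2r -ltnS.
  have := leq_dim_orthov1 form x (U :&: orth <<X>>)%VS.
  by case: (\dim (U :&: orth <<X>>)%VS) => // d; rewrite !ltnS.
by have := span_bound (vbasis V); rewrite size_tuple (span_basis (vbasisP V)).
Qed.

Hypothesis form_nondegenerate : nondegenerate form.

(* The upper bound on [\dim V]: a vector of V orthogonal to a complement of   *)
(* the orthogonal of V is orthogonal to everything.                           *)
Lemma dim_orthov V : (\dim V + \dim (orth V))%N = \dim {:vT}.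
Proof.
apply/eqP; rewrite eqn_leq; apply/andP; split; last first.
  by have := leq_dim_cap_orthov fullv V; rewrite capfv addnC.
have := leq_dim_cap_orthov V (orth V)^C.
suff -> : (V :&: orth (orth V)^C)%VS = 0%VS.
  rewrite dimv0 add0n dimv_compl => leV.
  by rewrite addnC -leq_subRL // dimvS ?subvf.
apply/eqP; rewrite -subv0 -(eqP form_nondegenerate) -(addv_complf (orth V)).
by rewrite orthov_add capvS // orthov_sym.
Qed.

Lemma orthovK V : orth (orth V) = V.
Proof.
(* By symmetry of orthogonality [V] lies in its double orthogonal; the dimensions agree. *)
apply/eqP; rewrite eq_sym eqEdim orthov_sym subvv /=.
by rewrite -(leq_add2l (\dim (orth V))) dim_orthov addnC dim_orthov.
Qed.

End OrthogonalDimension.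

Lemma dim_quotvs (K : fieldType) (V : vectType K) (S U : {vspace V}) :
  (S <= U)%VS -> (\dim (quotvs S U) + \dim S = \dim U)%N.
Proof.
move=> /capv_idPr sSU; have := limg_ker_dim (linfun (@projq K V S)) U.
by rewrite lker_projq sSU addnC.
Qed.

(* Alternating forms are skew-symmetric, so the type {skew_symmetric P} adds  *)
(* nothing to w_alternating; it makes the library's orthov and nondegenerate  *)
(* applicable. w_alternating itself is not redundant in characteristic 2.     *)
Theorem proposition4p1 (K : fieldType) (n k : nat) (P : vectType K)
    (w : {skew_symmetric P}) (S alpha : {vspace P})
    (w_alternating : forall u : P, w u u = 0)
    (w_nondegenerate : nondegenerate w)
    (dimP : \dim {:P} = (2 * n)%N)
    (S_isotropic : (S <= orthov w S)%VS)
    (le_kn : (k <= n)%N)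
    (dimS : \dim S = (n - k)%N) :
  let lM := \dim (quotvs S ((alpha :&: orthov w S) + S)%VS) in
  let lMc := \dim (quotvs S ((orthov w alpha :&: orthov w S) + S)%VS) in
  (lM + lMc = 2 * k)%N /\
  (lM = 0%N ->
     lMc = (2 * k)%N /\
     forall v : P, v \in orthov w S ->
       exists2 v' : P, v' \in (orthov w S :&: orthov w alpha)%VS & v - v' \in S).
Proof.
move=> lM lMc.
have dimO := dim_orthov w_nondegenerate.
have capSS (U : {vspace P}) :
    (\dim ((U :&: orthov w S) + S)%VS + \dim (U :&: S)%VS
       = \dim (U :&: orthov w S)%VS + \dim S)%N.
  by rewrite -(dimv_sum_cap _ S) -capvA (capv_idPr S_isotropic).
have dimM := dim_quotvs (addvSr (alpha :&: orthov w S)%VS S).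
have dimMc := dim_quotvs (addvSr (orthov w alpha :&: orthov w S)%VS S).
rewrite -/lM in dimM; rewrite -/lMc in dimMc.
have dimS' := dimO S; rewrite dimP in dimS'.
have lM_lMc : (lM + lMc = 2 * k)%N.
  (* In this linear system every term in [alpha] cancels, leaving [2 * n - 2 * \dim S]. *)
  have := capSS alpha; have := capSS (orthov w alpha).
  have := dimO (alpha + S)%VS; rewrite orthov_add.
  have := dimO (alpha + orthov w S)%VS; rewrite orthov_add orthovK // dimP.
  have := dimv_sum_cap alpha S; have := dimv_sum_cap alpha (orthov w S).
  lia.
split=> // lM0; split=> [|v Sv]; first by lia.
(* Both sides have dimension [n + k]: the left is [lMc + \dim S], the right [2 * n - \dim S]. *)
have /eqP fullMc : ((orthov w alpha :&: orthov w S) + S == orthov w S)%VS.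
  by rewrite eqEdim subv_add capvSr S_isotropic /=; lia.
have: v \in ((orthov w alpha :&: orthov w S) + S)%VS by rewrite fullMc.
case/memv_addP=> [v' v'M [s sS ->]].
by exists v'; [rewrite capvC | rewrite addrC addKr].
Qed.
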